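(* Let $1\le k\le n$. Let $S_1$ and $S_2$ be two $k$-out-of-$n$ systems with one cold standby unit each, with lifetimes $T_1$ and $T_2$; let $X_1,\ldots,X_n$ and $Y_1,\ldots,Y_n$ be the lifetimes of the active components of $S_1$ and $S_2$, respectively, and let $Z_i$ be the lifetime of the standby unit of $S_i$, $i=1,2$ (arbitrary distributions allowed). If $X_1,\ldots,X_n,Z_1$ are independent, $Y_1,\ldots,Y_n,Z_2$ are independent, $X_i\le_{hr}Y_i$ for $i=1,\ldots,n$, and $Z_1\le_{st}Z_2$, then for any $t$ such that $P(X_{1:n}>t)>0$, $$[T_1\mid X_{1:n}>t]\le_{st}[T_2\mid Y_{1:n}>t]$$ and, in consequence, $$E(T_1-t\mid X_{1:n}>t)\le E(T_2-t\mid Y_{1:n}>t).$$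
   Context: Lifetimes are non-negative random variables; expectations may be infinite. For $W_1,\ldots,W_n$ let $W_{1:n}\le\cdots\le W_{n:n}$ be the order statistics and $W_{n+1:n}:=\infty$. The system lifetimes are $T_1=\min(X_{n-k+1:n}+Z_1,\,X_{n-k+2:n})$ and $T_2=\min(Y_{n-k+1:n}+Z_2,\,Y_{n-k+2:n})$. $X\le_{st}Y$ means $P(X>s)\le P(Y>s)$ for all $s$. $X\le_{hr}Y$ (hazard rate order) means that $P(Y>t)/P(X>t)$ is non-decreasing in $t$ over those $t$ for which $P(X>t)>0$ or $P(Y>t)>0$, where $a/0:=\infty$ for $a>0$. For an event $A$ with positive probability, $[X\mid A]$ denotes a random variable having the conditional distribution of $X$ given $A$. *)

(* Defs.v *)
From HB Require Import structures.
From mathcomp Require Import all_boot all_order all_algebra.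
From mathcomp Require Import all_classical all_reals all_analysis.
From mathcomp Require Import measurable_realfun.

Set Implicit Arguments.
Unset Strict Implicit.
Unset Printing Implicit Defensive.

Import Order.TTheory GRing.Theory Num.Theory.

Local Open Scope classical_set_scope.
Local Open Scope ring_scope.
Local Open Scope ereal_scope.

Definition mutually_independent (d : measure_display) (O : measurableType d)
    (R : realType) (P : probability O R) (I : finType)
    (X : I -> {RV P >-> R}) : Prop :=
  forall (J : {set I}) (B : I -> set R), (forall i, measurable (B i)) ->
    P (\bigcap_(i in [set` J]) (X i @^-1` B i)) =
    \prod_(i in J) P (X i @^-1` B i).

(* The two random variables may live on different probability spaces. *)
Definition le_st (d1 d2 : measure_display)
    (O1 : measurableType d1) (O2 : measurableType d2) (R : realType)
    (P1 : probability O1 R) (P2 : probability O2 R)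
    (X : {RV P1 >-> R}) (Y : {RV P2 >-> R}) : Prop :=
  forall s : R, ccdf X s <= ccdf Y s.

(* The quotients are in \bar R, where 0^-1 = +oo, so that a / 0 = +oo for
   a > 0. *)
Definition le_hr (d1 d2 : measure_display)
    (O1 : measurableType d1) (O2 : measurableType d2) (R : realType)
    (P1 : probability O1 R) (P2 : probability O2 R)
    (X : {RV P1 >-> R}) (Y : {RV P2 >-> R}) : Prop :=
  forall s t : R, (s <= t)%R ->
    0 < ccdf X s \/ 0 < ccdf Y s ->
    0 < ccdf X t \/ 0 < ccdf Y t ->
    ccdf Y s / ccdf X s <= ccdf Y t / ccdf X t.

(* P(. | A), which is P itself if P A = 0.  [X | A] is the measurable
   function X seen as a random variable on this probability space. *)
Definition cond_probability (d : measure_display) (O : measurableType d)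
    (R : realType) (P : probability O R) (A : set O) (mA : measurable A) :
    probability O R :=
  mnormalize (mrestr P mA) P.

Lemma cond_probabilityE (d : measure_display) (O : measurableType d)
    (R : realType) (P : probability O R) (A : set O) (mA : measurable A)
    (B : set O) :
  0 < P A -> cond_probability P mA B = P (B `&` A) / P A.
Proof.
move=> PA; have PAfin : P A \is a fin_num by exact: fin_num_measure.
rewrite /cond_probability /= /mnormalize /= /mrestr !setTI.
case: ifPn => [/orP[/eqP PA0|/eqP PAy]|_].
- by rewrite PA0 ltxx in PA.
- by rewrite PAy in PAfin.
- rewrite -{2}(fineK PAfin) inver; case: eqP => // PA0.
  by rewrite -(fineK PAfin) PA0 ltxx in PA.
Qed.

Section order_statistics.
Variables (R : realType) (n : nat).
Implicit Types (w : 'I_n -> R).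

(* The ranks i range over 1, ..., n + 1; the rank n + 1 yields +oo. *)
Definition order_stat w (i : nat) : \bar R :=
  nth +oo [seq x%:E | x <- sort <=%R [seq w j | j <- enum 'I_n]] i.-1.

Lemma order_statS_le w (i : nat) (r : R) :
  (order_stat w i.+1 <= r%:E) = (i < #|[pred j | (w j <= r)%R]|)%N.
Proof.
rewrite /order_stat /=; set s := sort _ _.
have ss : sorted <=%R s by exact/sort_le_sorted.
have cE : #|[pred j | (w j <= r)%R]| = count (fun x => (x <= r)%R) s.
  rewrite /s (permP (permEl (perm_sort _ _))) count_map enumT cardE size_filter.
  by apply: eq_count.
rewrite cE; have [isz|szi] := ltnP i (size s); last first.
  rewrite nth_default ?size_map// leye_eq /=; apply/esym/negbTE.
  by rewrite -leqNgt (leq_trans (count_size _ _)).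
rewrite (nth_map 0%R)// lee_fin; apply/idP/idP => [|ic]; last exact: nth_count_le.
apply: contraTT; rewrite -leqNgt -ltNge => ci.
by apply: nth_count_gt; rewrite // ci.
Qed.

Lemma order_stat_fin_num w (i : nat) :
  (0 < i <= n)%N -> order_stat w i \is a fin_num.
Proof.
case: i => // i /= ilen; rewrite /order_stat (nth_map 0%R)//.
by rewrite size_sort size_map size_enum_ord.
Qed.

Lemma order_statS_n w : order_stat w n.+1 = +oo.
Proof.
by rewrite /order_stat nth_default// size_map size_sort size_map size_enum_ord.
Qed.

End order_statistics.

Section standby_system.
Variables (d : measure_display) (O : measurableType d) (R : realType) (n : nat).
Variables (X : 'I_n -> {mfun O >-> R}) (Z : {mfun O >-> R}) (k : nat).

Lemma measurable_order_stat (i : nat) :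
  measurable_fun [set: O] (fun w => order_stat (X ^~ w) i).
Proof.
wlog [j ->] : i / exists j, i = j.+1.
  move=> H; case: i => [|i]; last by apply: H; exists i.
  by apply: (H 1%N); exists 0%N.
move=> mT; apply: (measurability _ (ErealGenOInfty.measurableE R)) => //.
move=> _ [_ [r ->] <-]; rewrite setTI.
rewrite [X in measurable X](_ : _ =
  ~` \bigcup_(J in [set J : {set 'I_n} | (j < #|J|)%N])
     \bigcap_(l in [set` J]) (X l @^-1` `]-oo, r])).
  apply: measurableC; apply: fin_bigcup_measurable => // J _.
  apply: fin_bigcap_measurable => // l _.
  exact: measurable_funPTI.
apply/seteqP; split=> [w /=|w /= H].
  rewrite in_itv/= andbT ltNge order_statS_le -leqNgt => jn [J /= jJ JX].
  have /subset_leq_card JS : J \subset [pred l | (X l w <= r)%R].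
    by apply/fintype.subsetP => l lJ; have := JX l lJ;
      rewrite /= in_itv.
  by have := leq_trans jJ (leq_trans JS jn); rewrite ltnn.
rewrite in_itv/= andbT ltNge order_statS_le; apply/negP => jn; apply: H.
exists [set l | (X l w <= r)%R]%SET => [|l] /=; first by rewrite cardsE.
by rewrite finset.inE in_itv.
Qed.

Lemma measurable_order_stat_gt (i : nat) (t : R) :
  measurable [set w | t%:E < order_stat (X ^~ w) i].
Proof.
rewrite -[X in measurable X]setTI.
exact: (emeasurable_fun_o_infty measurableT (@measurable_order_stat i)).
Qed.

(* Lifetime of the k-out-of-n system with components X and cold standby unit
   Z.  For k = 1 the second rank is n + 1, so that the minimum is its first
   argument. *)
Definition standby_lifetime (w : O) : R :=
  fine (mine (order_stat (X ^~ w) (n - k).+1 + (Z w)%:E)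
             (order_stat (X ^~ w) (n - k).+2)).

(* Nothing is lost by taking the real part. *)
Lemma standby_lifetimeE (w : O) : (0 < k <= n)%N ->
  (standby_lifetime w)%:E =
  mine (order_stat (X ^~ w) (n - k).+1 + (Z w)%:E)
       (order_stat (X ^~ w) (n - k).+2).
Proof.
move=> /andP[k0 kn]; rewrite /standby_lifetime fineK//.
have nkn : (n - k < n)%N by rewrite ltn_subLR// -{1}[n]add0n ltn_add2r.
have f1 : order_stat (X ^~ w) (n - k).+1 + (Z w)%:E \is a fin_num.
  by rewrite fin_numD order_stat_fin_num.
case: (ltnP (n - k).+1 n) => h.
  by rewrite minEle; case: ifP => _ //; rewrite order_stat_fin_num.
rewrite (_ : (n - k).+2 = n.+1); last by congr S; apply/eqP; rewrite eqn_leq nkn.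
by rewrite order_statS_n minEle leey.
Qed.

Lemma measurable_standby_lifetime : measurable_fun [set: O] standby_lifetime.
Proof.
apply: (@measurableT_comp _ _ _ _ _ _ (@fine R)) => //.
apply: measurable_mine; last exact: measurable_order_stat.
by apply: emeasurable_funD; [exact: measurable_order_stat|exact/measurable_EFinP].
Qed.

HB.instance Definition _ :=
  isMeasurableFun.Build _ _ _ _ standby_lifetime measurable_standby_lifetime.

End standby_system.

(* Main.v *)
(* Conditionally on all components surviving [t], the components and the standby
   unit are still independent, and the hazard rate order says exactly that each
   component of the first system is then stochastically smaller than its
   counterpart.  The event [T > s] is an open upper set of the vector of
   lifetimes, so it remains to see that the probability of such a set increases
   when independent coordinates increase stochastically.  An open upper set is
   an increasing limit of finite unions of open orthants with rational corners.
   For such a union only finitely many levels matter in each coordinate; its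
   probability is a finite sum of products, in which the marginals can be
   exchanged one at a time.  Finally, [T - t] is almost surely nonnegative under
   the conditional law, hence its mean is the integral of its survival
   function. *)
Require Import Defs.
From HB Require Import structures.
From mathcomp Require Import all_boot all_order all_algebra.
From mathcomp Require Import all_classical all_reals all_analysis.
From mathcomp Require Import measurable_realfun.
From mathcomp Require Import lra.

Set Implicit Arguments.
Unset Strict Implicit.
Unset Printing Implicit Defensive.

Import Order.TTheory GRing.Theory Num.Theory.

Local Open Scope classical_set_scope.
Local Open Scope ring_scope.
Local Open Scope ereal_scope.

(** * Product weights on a finite product of finite sets *)

Section coordinatewise_comparison.
Local Open Scope ring_scope.
Variables (R : realDomainType) (I T : finType).
Implicit Types (a : {ffun I -> T}) (p q : I -> T -> R).

Definition ffun_upd a (i : I) (x : T) : {ffun I -> T} :=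
  [ffun j => if j == i then x else a j].

(** The functions are grouped by their values off [i]; the member with value [x0] at [i] represents
    its class. *)
Lemma sum_ffun_upd (x0 : T) (i : I) (F : {ffun I -> T} -> R) :
  \sum_a F a = \sum_(a : {ffun I -> T} | a i == x0) \sum_x F (ffun_upd a i x).
Proof.
rewrite (partition_big (fun a => ffun_upd a i x0)
  (fun a : {ffun I -> T} => a i == x0))/=;
  last by move=> a _; rewrite ffunE eqxx.
apply: eq_bigr => a /eqP ai.
rewrite (reindex_onto (ffun_upd a i) (fun b : {ffun I -> T} => b i)); last first.
  move=> b /eqP <-; apply/ffunP => j; rewrite !ffunE.
  by case: eqP => [->|].
apply: eq_bigl => x; rewrite ffunE eqxx eqxx andbT; apply/eqP/ffunP => j.
by rewrite !ffunE; case: eqP => [->|].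
Qed.

(* The factors [p i] are replaced by [q i] one coordinate at a time. *)
Lemma ler_sum_prod_ffun (x0 : T) p q (g : {ffun I -> T} -> R) :
  (forall i x, 0 <= p i x) -> (forall i x, 0 <= q i x) ->
  (forall i a, \sum_x p i x * g (ffun_upd a i x) <=
               \sum_x q i x * g (ffun_upd a i x)) ->
  \sum_(a : {ffun I -> T}) (\prod_i p i (a i)) * g a <=
  \sum_(a : {ffun I -> T}) (\prod_i q i (a i)) * g a.
Proof.
move=> p0 q0 pq; pose h (s : seq I) i := if i \in s then q i else p i.
have hq a : \prod_i q i (a i) = \prod_i h (enum I) i (a i).
  by apply: eq_bigr => i _; rewrite /h mem_enum.
under [leRHS]eq_bigr do rewrite hq.
elim: (enum I) (enum_uniq I) => [_|i s IHs /= /andP[is_ us]].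
  by apply: ler_sum => a _; rewrite /h.
apply: le_trans (IHs us) _.
have updE (r : I -> T -> R) a x :
    (\prod_j r j (ffun_upd a i x j)) * g (ffun_upd a i x) =
    (\prod_(j | j != i) r j (a j)) * (r i x * g (ffun_upd a i x)).
  rewrite (bigD1 i)//= ffunE eqxx -mulrA mulrCA; congr (_ * _).
  by apply: eq_bigr => j /negbTE ji; rewrite ffunE ji.
(* As [i] is not in [s], the two families differ only at [i]: each class carries a common
   nonnegative factor, and what remains is [pq]. *)
rewrite !(sum_ffun_upd x0 i); apply: ler_sum => a _.
under eq_bigr do rewrite updE; under [leRHS]eq_bigr do rewrite updE.
rewrite -!mulr_sumr (_ : \prod_(j | j != i) h (i :: s) j (a j) =
    \prod_(j | j != i) h s j (a j)); last first.
  by apply: eq_bigr => j /negbTE ji; rewrite /h inE ji.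
rewrite /h inE eqxx (negbTE is_)/=; apply: ler_wpM2l (pq i a).
by apply: prodr_ge0 => j _; case: ifP.
Qed.

End coordinatewise_comparison.

(** * Discretised random variables *)

Section finite_valued.
Variables (d : measure_display) (O : measurableType d) (R : realType).
Variables (P : probability O R) (T : finType).

Lemma fine_probability_preimage (A : O -> T) (D : pred T) :
  (forall x, measurable (A @^-1` [set x])) ->
  fine (P (A @^-1` [set x | D x])) =
  (\sum_x fine (P (A @^-1` [set x])) * (D x)%:R)%R.
Proof.
move=> mA; rewrite [X in fine (P X)](_ : _ =
    \bigcup_(x in [set` enum D]) (A @^-1` [set x])); last first.
  apply/seteqP; split=> [w /= Dw|w [x /=]].
    by exists (A w); rewrite //= mem_enum.
  by rewrite mem_enum => Dx ->.
rewrite measure_fin_bigcup//; last first.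
  by move=> x y _ _ [w [/= <- <-]].
rewrite -fsbig_seq ?enum_uniq// big_enum/=.
rewrite (eq_bigr (fun x => (fine (P (A @^-1` [set x])))%:E)); last first.
  by move=> x _; rewrite fineK// fin_num_measure.
rewrite sumEFin/=.
rewrite big_mkcond; apply: eq_bigr => x _.
by rewrite /in_mem/=; case: (D x); rewrite ?mulr1 ?mulr0.
Qed.

End finite_valued.

Section levels.
Variables (R : realType) (J : finType) (c : J -> R).

(** Replaces a real coordinate by a finite-valued one that still decides membership in the
    orthants. *)
Definition levels_below (x : R) : {set J} := [set j | (c j < x)%R]%SET.

Lemma measurable_levels_below (S : {set J}) :
  measurable (levels_below @^-1` [set S]).
Proof.
rewrite [X in measurable X](_ : _ = \bigcap_(j in [set: J])
    (if j \in S then `]c j, +oo[%classic else `]-oo, c j]%classic)).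
  apply: fin_bigcap_measurable => [|j _]; first exact: finite_finset.
  by case: ifP.
apply/seteqP; split=> [x /= <- j _|x /= xS].
  by rewrite inE; case: ltP => xj; rewrite /= in_itv/= ?andbT.
apply/setP => j; rewrite inE; have := xS j I.
by case: ifP => _; rewrite /= in_itv/= ?andbT// leNgt => /negbTE.
Qed.

End levels.

(* For nonempty [K], some level of [K] lies below [W] iff the lowest one does,
   so both sides are values of survival functions. *)
Lemma le_st_levels_below (R : realType) (d1 d2 : measure_display)
    (O1 : measurableType d1) (O2 : measurableType d2)
    (P1 : probability O1 R) (P2 : probability O2 R)
    (W : {RV P1 >-> R}) (V : {RV P2 >-> R})
    (J : finType) (c : J -> R) (K : pred J) :
  le_st W V ->
  (fine (P1 [set w | [exists j, K j && (j \in levels_below c (W w))]]) <=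
   fine (P2 [set w | [exists j, K j && (j \in levels_below c (V w))]]))%R.
Proof.
move=> WV; have [j0 Kj0|K0] := pickP K; last first.
  have E0 (T : Type) (U : T -> R) :
      [set w | [exists j, K j && (j \in levels_below c (U w))]] = set0.
    by apply/seteqP; split=> // w /= /existsP[j]; rewrite K0.
  by rewrite !E0 !measure0.
have [j Kj jmin] := arg_minP c Kj0.
have E (T : Type) (U : T -> R) :
    [set w | [exists j, K j && (j \in levels_below c (U w))]] =
    U @^-1` `]c j, +oo[.
  apply/seteqP; split=> w /=; rewrite in_itv/= andbT.
    by move=> /existsP[l /andP[Kl]]; rewrite inE; apply: le_lt_trans; exact: jmin.
  by move=> jw; apply/existsP; exists j; rewrite Kj inE.
rewrite !E; apply: fine_le; last exact: WV.
  by apply: fin_num_measure; exact: measurable_funPTI.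
by apply: fin_num_measure; exact: measurable_funPTI.
Qed.

(** * Finite unions of open orthants *)

Section orthants.
Variables (R : realType) (I J : finType) (b : J -> I -> R).

(** On discretised coordinates, this is membership in the union of the orthants with corners
    [b j]. *)
Definition common_level (a : {ffun I -> {set J}}) : bool :=
  [exists j, [forall i, j \in a i]].

(** With the other coordinates frozen, the indices [j] they allow form the predicate [K] of
    [le_st_levels_below]. *)
Lemma common_level_upd (a : {ffun I -> {set J}}) (i : I) (S : {set J}) :
  common_level (ffun_upd a i S) =
  [exists j, [forall l, (l != i) ==> (j \in a l)] && (j \in S)].
Proof.
apply: eq_existsb => j; apply/forallP/andP => [H|[/forallP H jS] l].
  split; last by have := H i; rewrite ffunE eqxx.
  by apply/forallP => l; have := H l; rewrite ffunE; case: eqP.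
by rewrite ffunE; have := H l; case: eqP.
Qed.

(** Membership depends on the discretised vector alone, whose law is a product of marginals by
    independence. *)
Lemma probability_orthants (d : measure_display) (O : measurableType d)
    (P : probability O R) (W : I -> {RV P >-> R}) :
  mutually_independent W ->
  fine (P [set w | exists j, forall i, (b j i < W i w)%R]) =
  (\sum_(a : {ffun I -> {set J}})
    (\prod_i fine (P (W i @^-1` (levels_below (b ^~ i) @^-1` [set a i])))) *
    (common_level a)%:R)%R.
Proof.
move=> indW.
pose A w : {ffun I -> {set J}} := [ffun i => levels_below (b ^~ i) (W i w)].
have mW i S : measurable (W i @^-1` (levels_below (b ^~ i) @^-1` [set S])).
  by apply: measurable_funPTI; exact: measurable_levels_below.
have AE a : A @^-1` [set a] = \bigcap_(i in [set` [set: I]%SET])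
    (W i @^-1` (levels_below (b ^~ i) @^-1` [set a i])).
  apply/seteqP; split=> [w /= <- i _ /=|w /= H]; first by rewrite ffunE.
  by apply/ffunP => i; rewrite ffunE; apply: H; rewrite /= inE.
rewrite [X in fine (P X)](_ : _ = A @^-1` [set a | common_level a]); last first.
  apply/seteqP; split=> w /=.
    move=> [j H]; apply/existsP; exists j; apply/forallP => i.
    by rewrite ffunE inE.
  by move=> /existsP[j /forallP H]; exists j => i; have := H i; rewrite ffunE inE.
rewrite fine_probability_preimage => [|a]; last first.
  by rewrite AE; apply: fin_bigcap_measurable => [|i _]; [exact: finite_finset|].
apply: eq_bigr => a _; congr (_ * _)%R; rewrite AE indW => [|i]; last first.
  exact: measurable_levels_below.
rewrite (eq_bigr (fun i => (fine (P (W i @^-1`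
    (levels_below (b ^~ i) @^-1` [set a i]))))%:E)); last first.
  by move=> i _; rewrite fineK// fin_num_measure.
by rewrite prodEFin/=; apply: eq_bigl => i; rewrite inE.
Qed.

Lemma le_st_orthants (d1 d2 : measure_display)
    (O1 : measurableType d1) (O2 : measurableType d2)
    (P1 : probability O1 R) (P2 : probability O2 R)
    (W : I -> {RV P1 >-> R}) (V : I -> {RV P2 >-> R}) :
  mutually_independent W -> mutually_independent V ->
  (forall i, le_st (W i) (V i)) ->
  (fine (P1 [set w | exists j, forall i, (b j i < W i w)%R]) <=
   fine (P2 [set w | exists j, forall i, (b j i < V i w)%R]))%R.
Proof.
move=> indW indV WV; rewrite !probability_orthants//.
apply: (@ler_sum_prod_ffun _ _ _ _
    (fun i S => fine (P1 (W i @^-1` (levels_below (b ^~ i) @^-1` [set S]))))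
    (fun i S => fine (P2 (V i @^-1` (levels_below (b ^~ i) @^-1` [set S])))))
  => //.
- exact: finset.set0.
- by move=> i S; exact: fine_ge0.
- by move=> i S; exact: fine_ge0.
- move=> i a.
  have pE d (O : measurableType d) (P : probability O R) (U : {RV P >-> R}) :
      (\sum_S fine (P (U @^-1` (levels_below (b ^~ i) @^-1` [set S]))) *
        (common_level (ffun_upd a i S))%:R)%R =
      fine (P [set w | [exists j, [forall l, (l != i) ==> (j \in a l)] &&
        (j \in levels_below (b ^~ i) (U w))]]).
    rewrite -(fine_probability_preimage P (A := levels_below (b ^~ i) \o U)
      (fun S => common_level (ffun_upd a i S))); last first.
      move=> S; rewrite comp_preimage; apply: measurable_funPTI.
      exact: measurable_levels_below.
    by congr (fine (P _)); apply/seteqP; split=> w /=; rewrite common_level_upd.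
  rewrite !pE.
  exact: (@le_st_levels_below _ _ _ _ _ _ _ _ _ _ _
    (fun j => [forall l, (l != i) ==> (j \in a l)]) (WV i)).
Qed.

End orthants.

(** * Open upper sets as limits of orthant unions *)

Section open_upper_sets.
Variables (R : realType) (I : finType) (U : set (I -> R)).
Hypothesis U_upper : forall x y, (forall i, x i <= y i)%R -> U x -> U y.
(** For an upper set this amounts to openness in the product topology. *)
Hypothesis U_open :
  forall x, U x -> exists2 y, forall i, (y i < x i)%R & U y.

(** Enumerates the rational points; a number that codes none yields the origin. *)
Let rat_pt (j : nat) : {ffun I -> rat} := odflt [ffun=> 0%R] (unpickle j).

Let good (m : nat) :=
  {j : 'I_m | `[< U (fun i => ratr (rat_pt j i)) >]}.

Let corner (m : nat) (j : good m) (i : I) : R := ratr (rat_pt (val j) i).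

Let approx (m : nat) : set (I -> R) :=
  [set x | exists j : good m, forall i, (corner j i < x i)%R].

(** A rational point strictly between [y] and [x] in every coordinate lies in [U] because it
    dominates [y], and its open orthant contains [x]. *)
Let bigcup_approx : \bigcup_m approx m = U.
Proof.
apply/seteqP; split=> [x [m _ [j jx]]|x /U_open[y yx Uy]].
  by apply: U_upper (asboolW (valP j)) => i; exact/ltW/jx.
have /choice[c cP] i : exists q : rat, (y i < ratr q < x i)%R.
  by have [q] := rat_in_itvoo (yx i); rewrite in_itv/=; exists q.
pose n := pickle (finfun c).
have nE : rat_pt n = finfun c by rewrite /rat_pt pickleK.
have Un : `[< U (fun i => ratr (rat_pt (Ordinal (ltnSn n)) i)) >].
  apply/asboolP; apply: U_upper Uy => i.
  by rewrite nE ffunE; case/andP: (cP i) => /ltW.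
exists n.+1 => //; exists (exist _ (Ordinal (ltnSn n)) Un) => i.
by rewrite /corner/= nE ffunE; case/andP: (cP i).
Qed.

Section event.
Variables (d : measure_display) (O : measurableType d) (P : probability O R).
Variable W : I -> {RV P >-> R}.

Lemma measurable_approx (m : nat) : measurable [set w | approx m (W ^~ w)].
Proof.
rewrite [X in measurable X](_ : _ = \bigcup_(j in [set: good m])
    \bigcap_(i in [set: I]) (W i @^-1` `]corner j i, +oo[)).
  apply: fin_bigcup_measurable => [|j _]; first exact: finite_finset.
  apply: fin_bigcap_measurable => [|i _]; first exact: finite_finset.
  exact: measurable_funPTI.
apply/seteqP; split=> w /=.
  by move=> [j jw]; exists j => // i _ /=; rewrite in_itv/= jw.
by move=> [j _ jw]; exists j => i; have := jw i Logic.I; rewrite /= in_itv/= andbT.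
Qed.

Let event_bigcup :
  [set w | U (W ^~ w)] = \bigcup_m [set w | approx m (W ^~ w)].
Proof. by rewrite -bigcup_approx. Qed.

Lemma cvg_approx :
  P [set w | approx m (W ^~ w)] @[m --> \oo] --> P [set w | U (W ^~ w)].
Proof.
rewrite event_bigcup; apply: nondecreasing_cvg_mu.
- exact: measurable_approx.
- by apply: bigcup_measurable => m _; exact: measurable_approx.
- move=> m p mp; apply/subsetPset => w [j jw].
  by exists (exist _ (widen_ord mp (val j)) (valP j)) => i; exact: jw.
Qed.

End event.

Lemma le_st_open_upper (d1 d2 : measure_display)
    (O1 : measurableType d1) (O2 : measurableType d2)
    (P1 : probability O1 R) (P2 : probability O2 R)
    (W : I -> {RV P1 >-> R}) (V : I -> {RV P2 >-> R}) :
  mutually_independent W -> mutually_independent V ->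
  (forall i, le_st (W i) (V i)) ->
  P1 [set w | U (W ^~ w)] <= P2 [set w | U (V ^~ w)].
Proof.
move=> indW indV WV.
apply: (lee_cvg_to (@cvg_approx _ _ P1 W) (@cvg_approx _ _ P2 V)); apply: nearW => m.
rewrite -[leLHS]fineK; last exact: fin_num_measure (measurable_approx _ _).
rewrite -[leRHS]fineK; last exact: fin_num_measure (measurable_approx _ _).
by rewrite lee_fin; exact: le_st_orthants.
Qed.

End open_upper_sets.

(** * Conditioning on a product event *)

(** [A] constrains each coordinate separately, so numerator and denominator of a conditional
    probability both factor. *)
Lemma mutually_independent_cond (d : measure_display) (O : measurableType d)
    (R : realType) (P : probability O R) (I : finType)
    (W : I -> {RV P >-> R}) (C : I -> set R) (A : set O) (mA : measurable A) :
  (forall i, measurable (C i)) -> A = \bigcap_i (W i @^-1` C i) ->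
  0 < P A -> mutually_independent W ->
  [/\ forall i, 0 < P (W i @^-1` C i),
      forall i B, measurable B -> cond_probability P mA (W i @^-1` B) =
        P (W i @^-1` (B `&` C i)) / P (W i @^-1` C i) &
      mutually_independent (fun i => W i : {RV cond_probability P mA >-> R})].
Proof.
move=> mC AE PA indW.
pose p i B := fine (P (W i @^-1` B)).
have pE i B : measurable B -> P (W i @^-1` B) = (p i B)%:E.
  by move=> mB; rewrite fineK// fin_num_measure//; exact: measurable_funPTI.
have p_ge0 i B : (0 <= p i B)%R by exact: fine_ge0.
have indE (B : I -> set R) : (forall i, measurable (B i)) ->
    P (\bigcap_i (W i @^-1` B i)) = (\prod_i p i (B i))%:E.
  move=> mB; have := indW [set: I]%SET B mB.
  rewrite (_ : [set` [set: I]%SET] = setT); last first.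
    by apply/seteqP; split=> // i _ /=; rewrite inE.
  by move=> ->; rewrite -prodEFin; apply: eq_big => i; rewrite ?inE// => _; exact: pE.
have PAE : P A = (\prod_i p i (C i))%:E by rewrite AE indE.
have pC_gt0 i : (0 < p i (C i))%R.
  rewrite lt_neqAle p_ge0 andbT; apply: contraTneq PA => pi0.
  by rewrite PAE (bigD1 i)//= -pi0 mul0r ltxx.
have condE (J : {set I}) (B : I -> set R) : (forall i, measurable (B i)) ->
    cond_probability P mA (\bigcap_(i in [set` J]) (W i @^-1` B i)) =
    (\prod_(i in J) (p i (B i `&` C i) / p i (C i)))%:E.
  move=> mB; rewrite cond_probabilityE//.
  (* Coordinates outside [J] carry [C i] alone and contribute a factor 1 after division. *)
  rewrite (_ : _ `&` A = \bigcap_i (W i @^-1`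
      ((if i \in J then B i else setT) `&` C i))); last first.
    rewrite AE; apply/seteqP; split=> [w [wB wC] i _ /=|w wBC].
      by case: ifPn => iJ; split=> //; [exact: wB|exact: wC|exact: wC].
    split=> [i /= iJ|i _]; first by have [] := wBC i Logic.I; rewrite iJ.
    by have [] := wBC i Logic.I.
  rewrite indE => [|i]; last by apply: measurableI => //; case: ifP.
  rewrite PAE inver gt_eqF ?prodr_gt0// -EFinM -prodf_div; congr _%:E.
  rewrite [RHS]big_mkcond; apply: eq_bigr => i _; case: ifP => // _.
  by rewrite setTI divff// gt_eqF.
have cond1E i B : measurable B -> cond_probability P mA (W i @^-1` B) =
    (p i (B `&` C i) / p i (C i))%:E.
  move=> mB; have := condE [set i]%SET (fun=> B) (fun=> mB).
  rewrite big_set1 => <-; congr (cond_probability P mA _).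
  apply/seteqP; split=> [w Bw j /=|w /(_ i)]; first by rewrite inE => /eqP ->.
  by apply; rewrite /= inE eqxx.
split=> [i|i B mB|J B mB].
- by rewrite pE// lte_fin.
- by rewrite cond1E// !pE//; [rewrite inver gt_eqF|exact: measurableI].
- by rewrite condE// -prodEFin; apply: eq_bigr => i _; rewrite cond1E.
Qed.

(** * Hazard rate order *)

(** If [ccdf X t] is 0, so is the left side; otherwise both quotients have positive denominators,
    which can be cleared. *)
Lemma le_hr_ccdf_mul (d1 d2 : measure_display)
    (O1 : measurableType d1) (O2 : measurableType d2) (R : realType)
    (P1 : probability O1 R) (P2 : probability O2 R)
    (X : {RV P1 >-> R}) (Y : {RV P2 >-> R}) (s t : R) :
  le_hr X Y -> (s <= t)%R -> ccdf X t * ccdf Y s <= ccdf X s * ccdf Y t.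
Proof.
move=> XY st; have Xts : ccdf X t <= ccdf X s by exact: ccdf_nonincreasing.
have : 0 <= ccdf X t by exact: measure_ge0.
rewrite le_eqVlt => /predU1P[<-|Xt0]; first by rewrite mul0e mule_ge0.
have Xs0 := lt_le_trans Xt0 Xts.
have := XY _ _ st (or_introl Xs0) (or_introl Xt0).
have fX r : ccdf X r \is a fin_num by exact: fin_num_measure.
have fY r : ccdf Y r \is a fin_num by exact: fin_num_measure.
move: Xt0 Xs0.
rewrite -(fineK (fX s)) -(fineK (fX t)) -(fineK (fY s)) -(fineK (fY t)).
rewrite !lte_fin => Xt0 Xs0; rewrite !inver !gt_eqF// -!EFinM !lee_fin.
by rewrite ler_pdivrMr// mulrAC ler_pdivlMr// mulrC (mulrC (fine (ccdf Y t))).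
Qed.

(* [s := -1] in the cross-multiplied order, both survival functions being 1
   there. *)
Lemma le_hr_st (d1 d2 : measure_display)
    (O1 : measurableType d1) (O2 : measurableType d2) (R : realType)
    (P1 : probability O1 R) (P2 : probability O2 R)
    (X : {RV P1 >-> R}) (Y : {RV P2 >-> R}) :
  (forall w, (0 <= X w)%R) -> (forall w, (0 <= Y w)%R) ->
  le_hr X Y -> le_st X Y.
Proof.
have ccdf1 d (O : measurableType d) (P : probability O R) (W : {RV P >-> R}) r :
    (forall w, (0 <= W w)%R) -> (r < 0)%R -> ccdf W r = 1.
  move=> W0 r0; rewrite -(probability_setT P); congr (P _).
  by apply/seteqP; split=> // w _ /=; rewrite in_itv/= andbT (lt_le_trans r0).
move=> X0 Y0 XY t.
have [t0|t0] := ltP t 0%R; first by rewrite !ccdf1.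
have := @le_hr_ccdf_mul _ _ _ _ _ _ _ _ _ (-1)%R t XY (le_trans (lerN10 R) t0).
by rewrite !(ccdf1 _ _ _ _ (-1)%R) ?mule1 ?mul1e ?ltrN10.
Qed.

(** Given [X > t], survival past [s] is survival past [Num.max s t], so this is the cross-multiplied
    order at [t] and that maximum. *)
Lemma le_st_cond_gt (d1 d2 : measure_display)
    (O1 : measurableType d1) (O2 : measurableType d2) (R : realType)
    (P1 : probability O1 R) (P2 : probability O2 R)
    (X : {RV P1 >-> R}) (Y : {RV P2 >-> R}) (t s : R) :
  le_hr X Y -> 0 < ccdf X t -> 0 < ccdf Y t ->
  P1 (X @^-1` (`]s, +oo[ `&` `]t, +oo[)) / ccdf X t <=
  P2 (Y @^-1` (`]s, +oo[ `&` `]t, +oo[)) / ccdf Y t.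
Proof.
move=> XY Xt0 Yt0.
have -> : `]s, +oo[%classic `&` `]t, +oo[%classic =
    `](Num.max s t), +oo[%classic.
  apply/seteqP; split=> x /=; rewrite !in_itv/= !andbT gt_max.
    by move=> [-> ->].
  by move=> /andP.
have := le_hr_ccdf_mul XY (_ : t <= Num.max s t)%R.
rewrite le_max lexx orbT => /(_ isT).
have fX r : ccdf X r \is a fin_num by exact: fin_num_measure.
have fY r : ccdf Y r \is a fin_num by exact: fin_num_measure.
rewrite -[P1 _]/(ccdf X (Num.max s t)) -[P2 _]/(ccdf Y (Num.max s t)).
move: Xt0 Yt0; rewrite -(fineK (fX t)) -(fineK (fY t)).
rewrite -(fineK (fX (Num.max s t))) -(fineK (fY (Num.max s t))).
rewrite !lte_fin => Xt0 Yt0; rewrite !inver !gt_eqF// -!EFinM !lee_fin => H.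
by rewrite ler_pdivrMr// mulrAC ler_pdivlMr// (mulrC (fine (ccdf Y _))).
Qed.

(** * Comparison of means *)

(** The null events allow [X - c] and [Y - c] to be replaced by their positive parts, whose means,
    possibly infinite, are integrals of survival functions. *)
Lemma le_st_expectation (d1 d2 : measure_display)
    (O1 : measurableType d1) (O2 : measurableType d2) (R : realType)
    (P1 : probability O1 R) (P2 : probability O2 R)
    (X : {RV P1 >-> R}) (Y : {RV P2 >-> R}) (c : R) :
  P1 [set w | (X w < c)%R] = 0 -> P2 [set w | (Y w < c)%R] = 0 ->
  le_st X Y ->
  'E_P1[(fun w => X w - c)%R] <= 'E_P2[(fun w => Y w - c)%R].
Proof.
move=> Xc Yc XY.
pose f d (O : measurableType d) (P : probability O R) (W : {RV P >-> R}) w :=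
  Num.max (W w - c)%R 0%R.
have mf d (O : measurableType d) (P : probability O R) (W : {RV P >-> R}) :
    measurable_fun setT (f d O P W).
  by apply: measurable_maxr => //; exact: measurable_funB.
have EE d (O : measurableType d) (P : probability O R) (W : {RV P >-> R}) :
    P [set w | (W w < c)%R] = 0 ->
    'E_P[(fun w => W w - c)%R] =
    \int[lebesgue_measure]_(r in `[0%R, +oo[) ccdf W (r + c).
  move=> Wc.
  pose F : {mfun O >-> R} := HB.pack (f d O P W)
    (isMeasurableFun.Build _ _ _ _ (f d O P W) (mf d O P W)).
  transitivity 'E_P[F].
    rewrite unlock; apply: ae_eq_integral => //.
    - by apply/measurable_EFinP; exact: measurable_funB.
    - by apply/measurable_EFinP; exact: mf.
    - exists [set w | (W w < c)%R]; split=> //.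
        by rewrite -[X in measurable X]setTI;
          exact: (measurable_fun_ltr (measurable_funPT W)).
      move=> w /= H; rewrite ltNge; apply/negP => cW; apply: H => _.
      by rewrite /F/= /f max_l// subr_ge0.
  rewrite (@ge0_expectation_ccdf _ _ _ P F) => [|w]; last first.
    by rewrite /F/= /f le_max lexx orbT.
  (* For [r >= 0], the positive part exceeds [r] exactly when [W > r + c]. *)
  apply: eq_integral => r; rewrite inE/= in_itv/= andbT => r0.
  congr (P _); apply/seteqP; split=> w /=; rewrite !in_itv/= !andbT.
    by rewrite /f lt_max [(r < 0)%R]ltNge r0 orbF ltrBrDr.
  by move=> H; rewrite /f lt_max ltrBrDr H.
rewrite !EE//; apply: ge0_le_integral => //=.
- apply: measurable_funTS; apply: measurableT_comp (ccdf_measurable X) _.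
  exact: measurable_funD.
- apply: measurable_funTS; apply: measurableT_comp (ccdf_measurable Y) _.
  exact: measurable_funD.
Qed.

(** * Survival of the system as an open upper event *)

Section standby_lifetime_counts.
Variables (R : realType) (n k : nat).

(* The system with component lifetimes [x (Some j)] and standby lifetime
   [x None] is alive at time [s]. *)
Definition counts (s : R) (x : option 'I_n -> R) : bool :=
  (#|[pred j | (x (Some j) <= s - x None)%R]| <= n - k)%N &&
  (#|[pred j | (x (Some j) <= s)%R]| <= (n - k).+1)%N.

(** Rank [i.+1] exceeds [r] exactly when at most [i] components are at most [r]; moving the standby
    time across gives the threshold [s - Z w]. *)
Lemma standby_lifetime_gt (d : measure_display) (O : measurableType d)
    (X : 'I_n -> {mfun O >-> R}) (Z : {mfun O >-> R}) (s : R) (w : O) :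
  (0 < k <= n)%N ->
  (s < standby_lifetime X Z k w)%R = counts s (fun i => oapp X Z i w).
Proof.
move=> kn; rewrite -lte_fin standby_lifetimeE// lt_min /counts/=; congr andb.
  by rewrite -lteBlDr// -EFinB ltNge order_statS_le -leqNgt.
by rewrite ltNge order_statS_le -leqNgt.
Qed.

(** Each failure counted for [y] is also counted for [x]. This reduces monotonicity and openness to
    linear inequalities in single components. *)
Lemma sub_counts (s t : R) (x y : option 'I_n -> R) :
  (forall j, y (Some j) <= t - y None -> x (Some j) <= s - x None)%R ->
  (forall j, y (Some j) <= t -> x (Some j) <= s)%R ->
  counts s x -> counts t y.
Proof.
move=> xy1 xy2 /andP[c1 c2]; apply/andP; split.
  by apply: leq_trans c1; apply/subset_leq_card/fintype.subsetP => j; exact: xy1.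
by apply: leq_trans c2; apply/subset_leq_card/fintype.subsetP => j; exact: xy2.
Qed.

(* Equivalent to [counts s x], but visibly an open condition on [x]. *)
Definition alive_after (s : R) : set (option 'I_n -> R) :=
  [set x | exists2 t, (s < t)%R & counts t x].

Lemma alive_after_upper (s : R) (x y : option 'I_n -> R) :
  (forall i, x i <= y i)%R -> alive_after s x -> alive_after s y.
Proof.
move=> xy [t st tx]; exists t => //; apply: sub_counts tx => j.
  by have := xy (Some j); have := xy None; lra.
by have := xy (Some j); lra.
Qed.

Lemma alive_after_open (s : R) (x : option 'I_n -> R) :
  alive_after s x -> exists2 y, forall i, (y i < x i)%R & alive_after s y.
Proof.
(* The first count adds a component and the standby unit, so this shift costs [(t - s) / 2] there,
   exactly what moving from [t] to the midpoint absorbs. *)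
move=> [t st tx]; exists (fun i => x i - (t - s) / 4)%R => [i|]; first by lra.
exists ((s + t) / 2)%R; first by lra.
by apply: sub_counts tx => j; lra.
Qed.

Lemma standby_lifetime_alive (d : measure_display) (O : measurableType d)
    (X : 'I_n -> {mfun O >-> R}) (Z : {mfun O >-> R}) (s : R) :
  (0 < k <= n)%N ->
  standby_lifetime X Z k @^-1` `]s, +oo[ =
  [set w | alive_after s (fun i => oapp X Z i w)].
Proof.
move=> kn; apply/seteqP; split=> w; rewrite /= in_itv/= andbT.
  move=> sT; exists ((s + standby_lifetime X Z k w) / 2)%R; first by lra.
  by rewrite -standby_lifetime_gt//; lra.
by move=> [t st]; rewrite -standby_lifetime_gt//; exact: lt_trans.
Qed.

(** No component fails by time [s], and [s - Z w <= s], so both counts are 0. This keeps the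
    lifetime above [t] on the conditioning event. *)
Lemma standby_lifetime_gt_min (d : measure_display) (O : measurableType d)
    (X : 'I_n -> {mfun O >-> R}) (Z : {mfun O >-> R}) (s : R) (w : O) :
  (0 < k <= n)%N -> (0 <= Z w)%R -> (forall j, s < X j w)%R ->
  (s < standby_lifetime X Z k w)%R.
Proof.
move=> kn Zw sX; rewrite standby_lifetime_gt//.
have c0 (r : R) : (r <= s)%R -> #|[pred j | (X j w <= r)%R]| = 0%N.
  move=> rs; apply: eq_card0 => j; rewrite inE; apply/negbTE.
  by rewrite -ltNge (le_lt_trans rs).
by rewrite /counts/= !c0//; lra.
Qed.

End standby_lifetime_counts.

Lemma order_stat1_gt (R : realType) (n : nat) (x : 'I_n -> R) (t : R) :
  t%:E < order_stat x 1 <-> forall j, (t < x j)%R.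
Proof.
rewrite ltNge order_statS_le -leqNgt leqn0; split=> [/eqP/card0_eq H j|H].
  by have := H j; rewrite inE ltNge => ->.
by apply/eqP/eq_card0 => j; rewrite inE leNgt H.
Qed.

(** * Residual lifetimes of the two systems *)

Theorem theorem4p2 (R : realType) (d1 d2 : measure_display)
    (O1 : measurableType d1) (O2 : measurableType d2)
    (P1 : probability O1 R) (P2 : probability O2 R)
    (n k : nat) (hk : (1 <= k <= n)%N)
    (X : 'I_n -> {RV P1 >-> R}) (Z1 : {RV P1 >-> R})
    (Y : 'I_n -> {RV P2 >-> R}) (Z2 : {RV P2 >-> R})
    (X_ge0 : forall i w, (0 <= X i w)%R) (Z1_ge0 : forall w, (0 <= Z1 w)%R)
    (Y_ge0 : forall i w, (0 <= Y i w)%R) (Z2_ge0 : forall w, (0 <= Z2 w)%R)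
    (XZ1_indep : mutually_independent (oapp X Z1))
    (YZ2_indep : mutually_independent (oapp Y Z2))
    (XY_hr : forall i, le_hr (X i) (Y i))
    (Z_st : le_st Z1 Z2)
    (t : R) (X_gt0 : 0 < P1 [set w | t%:E < order_stat (X ^~ w) 1]) :
  let P1t := cond_probability P1 (measurable_order_stat_gt X 1 t) in
  let P2t := cond_probability P2 (measurable_order_stat_gt Y 1 t) in
  let T1 : {mfun O1 >-> R} := standby_lifetime X Z1 k in
  let T2 : {mfun O2 >-> R} := standby_lifetime Y Z2 k in
  le_st (T1 : {RV P1t >-> R}) (T2 : {RV P2t >-> R}) /\
  'E_P1t[(fun w => T1 w - t)%R] <= 'E_P2t[(fun w => T2 w - t)%R].
Proof.
move=> P1t P2t T1 T2.
(* Survival of all components past [t] as a product event that leaves the standby unit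
   unconstrained. *)
pose C (i : option 'I_n) : set R := 
    if i is Some _ then `]t, +oo[%classic else setT.
have mC i : measurable (C i) by case: i => [i|]; [exact: measurable_itv|exact: measurableT].
have AE d (O : measurableType d) (W : 'I_n -> {mfun O >-> R}) (Z : {mfun O >-> R}) :
    [set w | t%:E < order_stat (W ^~ w) 1] =
    \bigcap_i ((oapp W Z i : O -> R) @^-1` C i).
  apply/seteqP; split=> w /=; rewrite order_stat1_gt.
    by move=> H [j|] _ //=; rewrite in_itv/= H.
  by move=> H j; have := H (Some j) Logic.I; rewrite /= in_itv/= andbT.
have [XC Xcond Xind] := mutually_independent_cond
  (measurable_order_stat_gt X 1 t) mC (AE _ _ X Z1) X_gt0 XZ1_indep.
have Xt0 i : 0 < ccdf (X i) t := XC (Some i).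
(* The hazard rate order implies the usual one; hence the second conditioning event is not null and
   [P2t] is a genuine conditional law. *)
have Yt0 i : 0 < ccdf (Y i) t.
  exact: lt_le_trans (Xt0 i) (le_hr_st (X_ge0 i) (Y_ge0 i) (XY_hr i) t).
have Y_gt0 : 0 < P2 [set w | t%:E < order_stat (Y ^~ w) 1].
  have := YZ2_indep [set: option 'I_n]%SET C mC.
  rewrite (_ : [set` [set: option 'I_n]%SET] = setT); last first.
    by apply/seteqP; split=> // i _ /=; rewrite inE.
  rewrite -AE => ->.
  apply: (big_ind (fun x : \bar R => 0 < x)) => // [x y|[i|] _].
  - exact: mule_gt0.
  - exact: Yt0.
  - by rewrite /C preimage_setT probability_setT lte01.
have [YC Ycond Yind] := mutually_independent_cond
  (measurable_order_stat_gt Y 1 t) mC (AE _ _ Y Z2) Y_gt0 YZ2_indep.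
(* Components compare through the hazard rate order, while the standby units keep their
   unconditional laws. *)
have st i : le_st (oapp X Z1 i : {RV P1t >-> R}) (oapp Y Z2 i : {RV P2t >-> R}).
  move=> s; rewrite /ccdf/= /pushforward Xcond// Ycond//.
  case: i => [i|] /=; first exact: le_st_cond_gt.
  by rewrite !setIT !preimage_setT !probability_setT inve1 !mule1; exact: Z_st.
have T_st : le_st (T1 : {RV P1t >-> R}) (T2 : {RV P2t >-> R}).
  move=> s; rewrite /ccdf/= /pushforward !standby_lifetime_alive//.
  exact: (le_st_open_upper (@alive_after_upper _ _ _ s)
    (@alive_after_open _ _ _ s) Xind Yind st).
split=> //; apply: le_st_expectation => //.
(* The event [T1 < t] is disjoint from the conditioning event. *)
- rewrite cond_probabilityE// (_ : _ `&` _ = set0) ?measure0 ?mul0e//.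
  apply/seteqP; split=> // w [/= Tt /order_stat1_gt tX].
  by have := lt_trans Tt (standby_lifetime_gt_min hk (Z1_ge0 w) tX); rewrite ltxx.
- rewrite cond_probabilityE// (_ : _ `&` _ = set0) ?measure0 ?mul0e//.
  apply/seteqP; split=> // w [/= Tt /order_stat1_gt tY].
  by have := lt_trans Tt (standby_lifetime_gt_min hk (Z2_ge0 w) tY); rewrite ltxx.
Qed.
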